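(* Let $(X,M,* )$ be a fuzzy metric space such that for all $a,b\in[0,1]$, $a*b\neq 0$ whenever $a\neq 0$ and $b\neq 0$. Then the union of any two bounded subsets of $X$ is bounded.
   Context: A continuous $t$-norm is a binary operation $*:[0,1]\times[0,1]\to[0,1]$ that is associative, commutative and continuous, satisfies $a*1=a$ for all $a\in[0,1]$, and satisfies $a*b\leq c*d$ whenever $a\leq c$ and $b\leq d$ (for $a,b,c,d\in[0,1]$). A fuzzy metric space (in the sense of George and Veeramani) is a triple $(X,M,* )$ where $X$ is a set, $*$ is a continuous $t$-norm, and $M:X\times X\times(0,\infty)\to[0,1]$ satisfies for all $x,y,z\in X$ and all $s,t>0$: (1) $M(x,y,t)>0$; (2) $M(x,y,t)=1$ if and only if $x=y$; (3) $M(x,y,t)=M(y,x,t)$; (4) $M(x,y,t)*M(y,z,s)\leq M(x,z,t+s)$; (5) $M(x,y,\cdot):(0,\infty)\to[0,1]$ is continuous. A subset $A$ of $X$ is bounded if there exist $r\in(0,1)$ and $t>0$ such that $M(x,y,t)>1-r$ for all $x,y\in A$. *)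

(* Defs.v *)
From mathcomp Require Import all_boot all_order all_algebra.
From mathcomp Require Import all_classical all_reals all_analysis.

Set Implicit Arguments.
Unset Strict Implicit.
Unset Printing Implicit Defensive.

Import Order.TTheory GRing.Theory Num.Theory.
Import numFieldNormedType.Exports.

Local Open Scope classical_set_scope.
Local Open Scope ring_scope.

(* A binary operation on [0, 1] is encoded as a function [T : R -> R -> R]
   mapping the unit square into [0, 1]; its values off the unit square are
   irrelevant, and continuity is that of the restriction to the square. *)
Record continuous_tnorm (R : realType) (T : R -> R -> R) : Prop := {
  tnorm_closed : forall a b, a \in `[0, 1] -> b \in `[0, 1] ->
    T a b \in `[0, 1];
  tnormA : forall a b c, a \in `[0, 1] -> b \in `[0, 1] -> c \in `[0, 1] ->
    T a (T b c) = T (T a b) c;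
  tnormC : forall a b, a \in `[0, 1] -> b \in `[0, 1] -> T a b = T b a;
  tnorm_continuous :
    {within `[0, 1]%classic `*` `[0, 1]%classic,
      continuous (fun p : R * R => T p.1 p.2)};
  tnorm1 : forall a, a \in `[0, 1] -> T a 1 = a;
  tnorm_le : forall a b c d, a \in `[0, 1] -> b \in `[0, 1] ->
    c \in `[0, 1] -> d \in `[0, 1] -> a <= c -> b <= d -> T a b <= T c d }.

(* George-Veeramani fuzzy metric; [M x y t] is meaningful only for [0 < t]. *)
Record fuzzy_metric_space (R : realType) (X : Type)
    (M : X -> X -> R -> R) (T : R -> R -> R) : Prop := {
  fm_tnorm : continuous_tnorm T;
  fm_range : forall x y t, 0 < t -> M x y t \in `[0, 1];
  fm_gt0 : forall x y t, 0 < t -> 0 < M x y t;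
  fm_eq1 : forall x y t, 0 < t -> M x y t = 1 <-> x = y;
  fm_sym : forall x y t, 0 < t -> M x y t = M y x t;
  fm_triangle : forall x y z s t, 0 < s -> 0 < t ->
    T (M x y t) (M y z s) <= M x z (t + s);
  fm_continuous : forall x y,
    {within `]0, +oo[%classic, continuous (M x y)} }.

Definition fm_bounded (R : realType) (X : Type) (M : X -> X -> R -> R)
    (A : set X) : Prop :=
  exists r t : R, [/\ r \in `]0, 1[, 0 < t &
    forall x y, A x -> A y -> M x y t > 1 - r].

(* Main.v *)
(* Fix a in A and b in B. If M x y t >= p on A and M x y s >= q on B, the
   triangle inequality through a and b bounds M x y (t + 1 + s) below by
   c = p * (M a b 1 * q) for x in A and y in B. The hypothesis on the t-norm
   gives c > 0, and c <= p, c <= q together with the monotonicity of M x y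
   handle pairs lying in the same set. *)
Require Import Defs.
From mathcomp Require Import all_boot all_order all_algebra.
From mathcomp Require Import all_classical all_reals all_analysis.
From mathcomp Require Import lra.

Set Implicit Arguments.
Unset Strict Implicit.
Unset Printing Implicit Defensive.

Import Order.TTheory GRing.Theory Num.Theory.
Import numFieldNormedType.Exports.

Local Open Scope classical_set_scope.
Local Open Scope ring_scope.

Lemma tnorm_le_l (R : realType) (T : R -> R -> R) (a b : R) :
  continuous_tnorm T -> a \in `[0, 1] -> b \in `[0, 1] -> T a b <= a.
Proof.
move=> hT a01 b01; rewrite -[leRHS](tnorm1 hT a01).
apply: (tnorm_le hT) => //; first by rewrite in_itv /= ler01 lexx.
by move: b01; rewrite in_itv => /andP[].
Qed.

Lemma tnorm_le_r (R : realType) (T : R -> R -> R) (a b : R) :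
  continuous_tnorm T -> a \in `[0, 1] -> b \in `[0, 1] -> T a b <= b.
Proof. by move=> hT a01 b01; rewrite (tnormC hT)// tnorm_le_l. Qed.

(** Apply the triangle inequality with [y] as the middle point: the factor [M y y (t - s)] equals 1,
    the unit of [T]. The case [s = t] is split off because times must be positive. *)
Lemma fuzzy_metric_le (R : realType) (X : Type) (M : X -> X -> R -> R)
    (T : R -> R -> R) (x y : X) (s t : R) :
  fuzzy_metric_space M T -> 0 < s -> s <= t -> M x y s <= M x y t.
Proof.
move=> hM s0; rewrite le_eqVlt => /orP[/eqP->//|st].
have ts0 : 0 < t - s by rewrite subr_gt0.
have := fm_triangle hM x y y ts0 s0.
by rewrite (fm_eq1 hM y y ts0).2// (tnorm1 (fm_tnorm hM)) ?(fm_range hM)// subrKC.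
Qed.

(** A non-strict positive lower bound combines directly with the monotonicity of [T]. *)
Lemma fm_boundedP (R : realType) (X : Type) (M : X -> X -> R -> R)
    (A : set X) :
  fm_bounded M A <-> exists c t : R, [/\ 0 < c <= 1, 0 < t &
    forall x y, A x -> A y -> c <= M x y t].
Proof.
split=> [[r [t [r01 t0 AM]]]|[c [t [/andP[c0 c1] t0 AM]]]].
  exists (1 - r), t; split=> // [|x y Ax Ay]; last exact/ltW/AM.
  by move: r01; rewrite in_itv /= => /andP[r0 r1]; apply/andP; split; lra.
(* Halving [c] makes the bound strict and keeps the radius positive even when [c = 1]. *)
exists (1 - c / 2), t; split=> // [|x y Ax Ay].
  by rewrite in_itv /=; apply/andP; split; lra.
by apply: lt_le_trans (AM _ _ Ax Ay); lra.
Qed.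

Theorem proposition2p8 (R : realType) (X : Type)
    (M : X -> X -> R -> R) (T : R -> R -> R)
    (hM : fuzzy_metric_space M T)
    (hT : forall a b : R, a \in `[0, 1] -> b \in `[0, 1] ->
       a <> 0 -> b <> 0 -> T a b <> 0)
    (A B : set X) (hA : fm_bounded M A) (hB : fm_bounded M B) :
  fm_bounded M (A `|` B).
Proof.
have hT' := fm_tnorm hM.
(* An empty set offers no base point, but then the union is just the other set. *)
have [->|/set0P[a Aa]] := eqVneq A set0.
  by rewrite set0U.
have [->|/set0P[b Bb]] := eqVneq B set0.
  by rewrite setU0.
have /fm_boundedP[p [t [/andP[p0 p1] t0 AM]]] := hA.
have /fm_boundedP[q [s [/andP[q0 q1] s0 BM]]] := hB.
(* Values of [T] on the unit square are nonnegative, so nonvanishing upgrades to positivity. *)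
have Tgt0 u v : u \in `[0, 1] -> v \in `[0, 1] -> 0 < u -> 0 < v -> 0 < T u v.
  move=> u01 v01 /lt0r_neq0/eqP u0 /lt0r_neq0/eqP v0; rewrite lt0r.
  have /[!in_itv]/= /andP[-> _] := tnorm_closed hT' u01 v01.
  by rewrite andbT; apply/eqP/hT.
have p01 : p \in `[0, 1] by rewrite in_itv /= ltW.
have q01 : q \in `[0, 1] by rewrite in_itv /= ltW.
(* The time 1 is an arbitrary positive choice. *)
set m := M a b 1.
have m01 : m \in `[0, 1] by apply: (fm_range hM).
have m0 : 0 < m by apply: (fm_gt0 hM).
have mq01 := tnorm_closed hT' m01 q01.
have c0 : 0 < T p (T m q) by rewrite !Tgt0.
have cp : T p (T m q) <= p by apply: tnorm_le_l.
have cq : T p (T m q) <= q.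
  by apply: le_trans (tnorm_le_r hT' m01 q01); apply: tnorm_le_r.
have s10 : 0 < 1 + s by lra.
have AB x y : A x -> B y -> T p (T m q) <= M x y (t + (1 + s)).
  move=> Ax By; apply: le_trans (fm_triangle hM x a y s10 t0).
  apply: (tnorm_le hT'); rewrite ?(fm_range hM)//; first exact: AM.
  (* The remaining leg from [a] to [y] is split at [b], its time [1 + s] into 1 and [s]. *)
  apply: le_trans (fm_triangle hM a b y s0 ltr01).
  by apply: (tnorm_le hT'); rewrite ?(fm_range hM)//; exact: BM.
have ts0 : 0 < t + (1 + s) by lra.
apply/fm_boundedP; exists (T p (T m q)), (t + (1 + s)); split=> //.
  by rewrite c0 (le_trans cp).
move=> x y [Ax|Bx] [Ay|By].
- apply: (le_trans cp); apply: le_trans (AM _ _ Ax Ay) _.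
  by apply: (fuzzy_metric_le _ _ hM) => //; lra.
- exact: AB.
- by rewrite (fm_sym hM)//; exact: AB.
- apply: (le_trans cq); apply: le_trans (BM _ _ Bx By) _.
  by apply: (fuzzy_metric_le _ _ hM) => //; lra.
Qed.
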